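(* There exists an instance of fair division with market values with $2$ agents and $6$ goods (with additive subjective utilities and additive market valuation) in which there is no allocation that is Pareto optimal with respect to the subjective utilities and SD-EF1 with respect to the market valuation.
   Context: An instance of fair division with market values $\langle \mathcal{N}, \mathcal{M}, v, (u_i)_{i\in\mathcal{N}}\rangle$ consists of a finite set $\mathcal{N}$ of $n$ agents, a finite set $\mathcal{M}$ of $m$ indivisible goods, a market valuation $v:2^{\mathcal{M}}\to\mathbb{R}_{\ge 0}$, and a subjective utility function $u_i:2^{\mathcal{M}}\to\mathbb{R}_{\ge 0}$ for each agent $i$. Here all these set functions are additive: $f(S)=\sum_{g\in S} f(\{g\})$ for all $S\subseteq\mathcal{M}$, with $f(\emptyset)=0$; write $f(g)=f(\{g\})$. An allocation $A=(A_1,\dots,A_n)$ is a partition of $\mathcal{M}$ into $n$ pairwise disjoint (possibly empty) bundles, with $A_i$ given to agent $i$ and $\bigcup_i A_i=\mathcal{M}$. $A$ is Pareto optimal (PO) with respect to the subjective utilities if there is no allocation $A'$ with $u_i(A'_i)\ge u_i(A_i)$ for all $i\in\mathcal{N}$ and at least one inequality strict. SD-preference under $v$: for $X,Y\subseteq\mathcal{M}$, write $X \succcurlyeq^{\mathsf{SD}}_{v} Y$ if for each good $g\in\mathcal{M}$, $|\{g'\in X: v(g')\ge v(g)\}|\ge |\{g'\in Y: v(g')\ge v(g)\}|$. $A$ is SD-EF1 with respect to the market valuation if for every $i,j\in\mathcal{N}$, either $A_j=\emptyset$ or $A_i\succcurlyeq^{\mathsf{SD}}_{v} A_j\setminus\{g\}$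 for some $g\in A_j$. *)

(* Defs.v *)
From HB Require Import structures.
From mathcomp Require Import all_boot all_order all_algebra.
From mathcomp Require Import reals.

Set Implicit Arguments.
Unset Strict Implicit.
Unset Printing Implicit Defensive.

Import Order.TTheory GRing.Theory Num.Theory.
Local Open Scope ring_scope.

(* The normalisation f set0 = 0 is the case S = set0 (empty sum). *)
Definition additive_set_fun (R : realType) (M : finType) (f : {set M} -> R) :
    Prop :=
  forall S : {set M}, f S = \sum_(g in S) f [set g].

Record instance (R : realType) (N M : finType) := Instance {
  market : {set M} -> R;
  utility : N -> {set M} -> R;
  market_ge0 : forall S, 0 <= market S;
  market_additive : additive_set_fun market;
  utility_ge0 : forall i S, 0 <= utility i S;
  utility_additive : forall i, additive_set_fun (utility i)
}.

(* Bundles may be empty, so this is not finset's [partition]. *)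
Definition allocation (N M : finType) (A : {ffun N -> {set M}}) : Prop :=
  (forall i j : N, i != j -> [disjoint A i & A j]) /\
  \bigcup_(i : N) A i = [set: M].

Definition pareto_optimal (R : realType) (N M : finType)
    (u : N -> {set M} -> R) (A : {ffun N -> {set M}}) : Prop :=
  ~ exists A' : {ffun N -> {set M}},
      [/\ allocation A',
          forall i : N, u i (A i) <= u i (A' i) &
          exists i : N, u i (A i) < u i (A' i)].

Definition sd_pref (R : realType) (M : finType) (v : {set M} -> R)
    (X Y : {set M}) : Prop :=
  forall g : M,
    (#|[set g' in Y | (v [set g] <= v [set g'])%R]| <=
     #|[set g' in X | (v [set g] <= v [set g'])%R]|)%N.

Definition sd_ef1 (R : realType) (N M : finType) (v : {set M} -> R)
    (A : {ffun N -> {set M}}) : Prop :=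
  forall i j : N,
    A j = set0 \/ exists2 g : M, g \in A j & sd_pref v (A i) (A j :\ g).

(* Main.v *)
(* Let the market value exactly the goods of a two-element set S, let one agent
   want exactly the goods of S and let the other want exactly the remaining ones.
   Giving everyone what they want maximizes both utilities, so in a Pareto optimal
   allocation the first agent gets all of S; the other agent then holds no good of
   positive market value, while the first still holds one after a removal. *)
Require Import Defs.
From mathcomp Require Import all_boot all_order all_algebra.
From mathcomp Require Import reals.

Set Implicit Arguments.
Unset Strict Implicit.
Unset Printing Implicit Defensive.

Import Order.TTheory GRing.Theory Num.Theory.

Section CountingValuation.
Local Open Scope ring_scope.
Variables (R : realType) (M : finType).
Implicit Types S T : {set M}.

(** One family provides every set function of the instance: the market value and both utilities
    differ only in [S]. *)
Definition count_in S T : R := #|T :&: S|%:R.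

Lemma count_in_ge0 S T : 0 <= count_in S T.
Proof. exact: ler0n. Qed.

Lemma count_in1 S g : count_in S [set g] = (g \in S)%:R.
Proof.
rewrite /count_in; case: (boolP (g \in S)) => gS.
  by rewrite (setIidPl _) ?sub1set// cards1.
by apply/eqP; rewrite pnatr_eq0 cards_eq0 setI_eq0 disjoints1.
Qed.

Lemma count_in_additive S : additive_set_fun (count_in S).
Proof.
move=> T; under eq_bigr do rewrite count_in1.
by rewrite -natr_sum -big_mkcondr sum1dep_card.
Qed.

Lemma count_in_le S T : count_in S T <= count_in S S.
Proof. by rewrite ler_nat setIid subset_leq_card// subsetIr. Qed.

Lemma count_in_lt S T : ~~ (S \subset T) -> count_in S T < count_in S S.
Proof.
by move=> ST; rewrite ltr_nat setIid proper_card// properE subsetIr subsetI subxx andbT.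
Qed.

End CountingValuation.

Section Counterexample.
Local Open Scope ring_scope.
Variables (R : realType) (M : finType) (S : {set M}).

Definition wanted (i : bool) : {set M} := if i then S else ~: S.

Definition separated_instance : instance R bool M :=
  Instance (@count_in_ge0 R M S) (@count_in_additive R M S)
    (fun i => @count_in_ge0 R M (wanted i))
    (fun i => @count_in_additive R M (wanted i)).

Lemma allocation_wanted : allocation (finfun wanted).
Proof.
split; last by rewrite big_bool !ffunE/= setUCr.
by case=> [] [] //= _; rewrite !ffunE/= -setI_eq0 1?[~: S :&: S]setIC setICr.
Qed.

(** If [A i] missed a good wanted by [i], the allocation [wanted] would dominate [A]: no agent
    loses, and [i] gains strictly. *)
Lemma pareto_optimal_wanted (A : {ffun bool -> {set M}}) i :
  pareto_optimal (utility separated_instance) A -> wanted i \subset A i.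
Proof.
move=> PO; apply/negPn/negP => nsub; apply: PO; exists (finfun wanted).
split; first exact: allocation_wanted.
  by move=> j; rewrite ffunE; exact: count_in_le.
by exists i; rewrite ffunE; exact: count_in_lt.
Qed.

Lemma no_pareto_optimal_sd_ef1 (A : {ffun bool -> {set M}}) : (1 < #|S|)%N ->
  allocation A -> pareto_optimal (utility separated_instance) A ->
  ~ sd_ef1 (market separated_instance) A.
Proof.
move=> S_gt1 [disjA _] /(@pareto_optimal_wanted _ true)/= SA /(_ false true).
have [s sS] : exists s, s \in S by apply/card_gt0P; exact: ltnW.
case=> [A0|[g _ /(_ s)]]; first by move/subsetP: SA => /(_ s sS); rewrite A0 inE.
(* Dominance is tested at the threshold [s], of market value 1, which only the goods of [S]
   reach. *)
have topE (T : {set M}) :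
    [set g' in T | count_in R S [set s] <= count_in R S [set g']] = T :&: S.
  by apply/setP => x; rewrite !inE !count_in1 sS ler_nat lt0b.
rewrite /= !topE; have -> : A false :&: S = set0.
  apply/eqP; rewrite setI_eq0; apply: disjointWr SA _; exact: disjA.
(* Agent [false] has count 0 at this threshold, so [S :\ g] must be empty, whereas [S] has at least
   two elements. *)
rewrite cards0 leqn0 cards_eq0 setIDAC (setIidPr SA) => /eqP Sg.
by move: S_gt1; rewrite (cardsD1 g) Sg cards0 addn0; case: (g \in S).
Qed.

End Counterexample.

Theorem theorem4 (R : realType) :
  exists (N M : finType) (I : instance R N M),
    [/\ #|N| = 2, #|M| = 6 &
        ~ exists A : {ffun N -> {set M}},
            [/\ allocation A,
                pareto_optimal (utility I) A &
                sd_ef1 (market I) A]].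
Proof.
(* Any two distinct goods serve; the first and the last are chosen. *)
pose S : {set 'I_6} := [set ord0; ord_max].
exists bool, 'I_6, (separated_instance R S).
split; [exact: card_bool | exact: card_ord | case=> A [allocA PO]].
by apply: no_pareto_optimal_sd_ef1 allocA PO; rewrite cards2.
Qed.
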